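(* Let $H$ be a complex Hilbert space and let $T=A+\mathrm{i}B\in B(H)$, where $A,B\in B(H)$ are self-adjoint. If $T^3$ and $T^2$ are self-adjoint and $B\geq 0$ (or $B\leq 0$), then $T$ is self-adjoint.
   Context: $H$ is a complex Hilbert space (possibly infinite-dimensional) and $B(H)$ is the algebra of bounded linear operators from $H$ into itself. For $S\in B(H)$, $S\geq 0$ (positive) means $\langle Sx,x\rangle\geq 0$ for all $x\in H$, and $S\leq 0$ means $-S\geq 0$. *)

(* Defs.v *)
From HB Require Import structures.
From mathcomp Require Import all_boot all_order all_algebra.
From mathcomp Require Import complex.
From mathcomp Require Import all_classical all_reals all_analysis.
Import Order.TTheory GRing.Theory Num.Theory.
Import numFieldNormedType.Exports.

Set Implicit Arguments.
Unset Strict Implicit.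
Unset Printing Implicit Defensive.

Local Open Scope classical_set_scope.
Local Open Scope ring_scope.

(* The form is linear in its first argument and conjugate-linear in its second;
   sqr_normrE makes the complete norm of H the one induced by the form. *)
HB.mixin Record CompleteNormedModule_isHilbert (R : realType) H
    of CompleteNormedModule R[i] H := {
  inner : {dot H for @Num.conj R[i]} ;
  sqr_normrE : forall x : H, `|x| ^+ 2 = inner x x
}.

#[short(type="hilbertType")]
HB.structure Definition Hilbert (R : realType) :=
  { H of CompleteNormedModule R[i] H & CompleteNormedModule_isHilbert R H }.

Section Operators.
Context {R : realType} {H : hilbertType R}.
Implicit Types S T : H -> H.

Definition bounded_op T := exists M : R, forall x, `|T x| <= M%:C%C * `|x|.

Lemma bounded_op_continuous (T : {linear H -> H}) :
  bounded_op T <-> continuous T.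
Proof.
rewrite -linear_bounded_continuous linear_boundedP; split=> [[M TM]|].
  near=> r => x; apply: (le_trans (TM x)); rewrite ler_wpM2r//.
  by near: r; apply: nbhs_pinfty_ge; apply/complex_realP; exists M.
move=> /pinfty_ex_gt0[M M0 TM]; exists (complex.Re M) => x.
by rewrite RRe_real ?gtr0_real.
Unshelve. all: by end_near. Qed.

Definition is_adjoint S T := forall x y, inner (S x) y = inner x (T y).

(* Adjoints are unique, so this says that S is its own adjoint. *)
Definition self_adjoint S := is_adjoint S S.

(* In R[i], 0 <= z means that z is real and nonnegative. *)
Definition positive_op S := forall x, 0 <= inner (S x) x.

Definition negative_op S := positive_op (\- S).

End Operators.

(* Main.v *)
Require Import Defs.
From HB Require Import structures.
From mathcomp Require Import all_boot all_order all_algebra.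
From mathcomp Require Import complex.
From mathcomp Require Import all_classical all_reals all_analysis.
Import Order.TTheory GRing.Theory Num.Theory.
Local Open Scope ring_scope.

(** Write q(x) = <Bx, x>.  Taking adjoints, T^* = A - iB, so the hypotheses say
    T^2 = (T^* )^2 and T^3 = (T^* )^3.  The first equality means AB = -BA, hence
    T^2 = A^2 - B^2.  The two together give
    T T^2 = (T^* )^3 = T^* (T^* )^2 = T^* T^2,
    that is, 2i B T^2 = 0, hence BA^2 = B^3 ([imaginary_part_relations]).

    Pairing this last identity with x and moving one A across by
    anticommutation gives q(Bx) = <B^3 x, x> = <BA^2 x, x> = - <ABA x, x>
    = - q(Ax).  If q has a constant sign, both sides must vanish, so q is zero
    on the range of B.  Evaluating q at the vector B(Bx) - Bx of that range then
    forces B^2 x = 0, and so Bx = 0 ([sa_eq0_of_form_range]).  Thus T = A. *)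

Section SelfAdjointPowers.
Set Implicit Arguments.
Unset Strict Implicit.
Context {R : realType} {H : hilbertType R}.

Lemma inner_xx_eq0 (x : H) : inner x x = 0 -> x = 0.
Proof. by rewrite -sqr_normrE => /eqP; rewrite sqrf_eq0 normr_eq0 => /eqP. Qed.

Lemma adjoint_unique (S S1 S2 : H -> H) :
  is_adjoint S S1 -> is_adjoint S S2 -> S1 =1 S2.
Proof.
move=> adj1 adj2 y; apply/eqP; rewrite -subr_eq0; apply/eqP/inner_xx_eq0.
by rewrite linearBr /= -adj1 -adj2 subrr.
Qed.

Lemma adjoint_comp (S S' U U' : H -> H) :
  is_adjoint S S' -> is_adjoint U U' -> is_adjoint (S \o U) (U' \o S').
Proof. by move=> adjS adjU x y /=; rewrite adjS adjU. Qed.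

Lemma adjoint_cartesian (T A B : H -> H) :
  self_adjoint A -> self_adjoint B -> (forall x, T x = A x + 'i%C *: B x) ->
  is_adjoint T (fun x => A x + (- 'i%C) *: B x).
Proof.
move=> A_sa B_sa T_eq x y; rewrite T_eq linearDl linearDr /= A_sa; congr (_ + _).
rewrite linearZl_LR linearZr_LR /= B_sa; congr (_ * _).
by apply/eqP; rewrite eq_complex /= oppr0 opprK !eqxx.
Qed.

(** The choices s = i and s = -i give T^2 and (T^* )^2 at once. *)
Lemma cartesian_sqr (A B : {linear H -> H}) (s : R[i]) (x : H) : s ^+ 2 = -1 ->
  A (A x + s *: B x) + s *: B (A x + s *: B x) =
  A (A x) - B (B x) + s *: (A (B x) + B (A x)).
Proof.
move=> s2; rewrite !linearD !linearZ /= scalerA -expr2 s2 scaleN1r.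
by rewrite [s *: B (A x) - _]addrC addrACA.
Qed.

(** Two self-adjoint consecutive powers give T T^2 = T^* T^2, so the imaginary
    part of T kills T^2, which by anticommutation is A^2 - B^2. *)
Lemma imaginary_part_relations (T A B : {linear H -> H}) :
  self_adjoint A -> self_adjoint B -> (forall x, T x = A x + 'i%C *: B x) ->
  self_adjoint (T \o T) -> self_adjoint (T \o T \o T) ->
  (forall x, A (B x) = - B (A x)) /\ (forall x, B (A (A x)) = B (B (B x))).
Proof.
move=> A_sa B_sa T_eq T2_sa T3_sa.
have i0 : 'i%C != 0 :> R[i] by rewrite eq_complex /= oner_eq0 andbF.
have eqN0 (z : H) : 'i%C *: z = (- 'i%C) *: z -> z = 0.
  move/eqP; rewrite scaleNr -addr_eq0 -scalerDr scaler_eq0 (negbTE i0) /=.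
  by rewrite -mulr2n -scaler_nat scaler_eq0 pnatr_eq0 => /eqP.
pose T' x := A x + (- 'i%C) *: B x.
have adjT : is_adjoint T T' := adjoint_cartesian A_sa B_sa T_eq.
have T2 x : T (T x) = T' (T' x).
  exact: (adjoint_unique T2_sa (adjoint_comp adjT adjT) x).
have T3 x : T (T (T x)) = T' (T' (T' x)).
  exact: (adjoint_unique T3_sa (adjoint_comp (adjoint_comp adjT adjT) adjT) x).
have TT x : T (T x) = A (A x) - B (B x) + 'i%C *: (A (B x) + B (A x)).
  by rewrite !T_eq cartesian_sqr ?complex.sqr_i.
have anti x : A (B x) + B (A x) = 0.
  apply: eqN0; apply: (addrI (A (A x) - B (B x))).
  by rewrite -TT T2 /T' cartesian_sqr ?sqrrN ?complex.sqr_i.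
split=> x; first by apply/eqP; rewrite -addr_eq0 anti.
have BT2 : B (T (T x)) = 0.
  apply: eqN0; apply: (addrI (A (T (T x)))).
  by rewrite -T_eq T3 T2.
by apply/eqP; rewrite -subr_eq0 -linearB -BT2 TT anti scaler0 addr0.
Qed.

(** For u = Bx the vector Bu - u lies again in the range of B, and expanding
    <B(Bu - u), Bu - u> leaves only the cross terms, -2 |Bu|^2. *)
Lemma sa_eq0_of_form_range (B : {linear H -> H}) :
  self_adjoint B -> (forall x, inner (B (B x)) (B x) = 0) ->
  forall x, B x = 0.
Proof.
move=> B_sa q0 x; apply: inner_xx_eq0; rewrite -B_sa.
suff -> : B (B x) = 0 by rewrite linear0l.
apply: inner_xx_eq0; have := q0 (B x - x).
rewrite !linearB /= !linearBl /= !q0 [inner (B (B (B x))) (B x)]B_sa sub0r subr0.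
by move/eqP; rewrite -opprD oppr_eq0 -mulr2n mulrn_eq0 => /eqP.
Qed.

(** Since <B(Bx), Bx> = - <B(Ax), Ax>, a form of constant sign takes here a
    value that is both nonnegative and nonpositive. *)
Lemma form_range_eq0 (A B : {linear H -> H}) :
  self_adjoint A -> self_adjoint B ->
  (forall x, A (B x) = - B (A x)) -> (forall x, B (A (A x)) = B (B (B x))) ->
  positive_op B \/ negative_op B -> forall x, inner (B (B x)) (B x) = 0.
Proof.
move=> A_sa B_sa anti BAA B_sign x.
have qBA : inner (B (B x)) (B x) = - inner (B (A x)) (A x).
  by rewrite -B_sa -BAA -A_sa anti linearNl opprK.
apply/eqP; rewrite eq_le; case: B_sign => B_sign.
  by rewrite {1}qBA oppr_le0 !B_sign.
have qN y : inner (B y) y <= 0.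
  by rewrite -oppr_ge0 -linearNl; apply: B_sign.
by rewrite qN qBA oppr_ge0 qN.
Qed.

End SelfAdjointPowers.

Theorem theorem2p4 (R : realType) (H : hilbertType R)
    (T A B : {linear H -> H})
    (T_bounded : bounded_op T) (A_bounded : bounded_op A)
    (B_bounded : bounded_op B)
    (A_sa : self_adjoint A) (B_sa : self_adjoint B)
    (T_eq : forall x : H, T x = A x + 'i%C *: B x)
    (T3_sa : self_adjoint (T \o T \o T))
    (T2_sa : self_adjoint (T \o T))
    (B_sign : positive_op B \/ negative_op B) :
  self_adjoint T.
Proof.
have [anti BAA] := imaginary_part_relations A_sa B_sa T_eq T2_sa T3_sa.
have B0 := sa_eq0_of_form_range B_sa (form_range_eq0 A_sa B_sa anti BAA B_sign).
by move=> x y; rewrite !T_eq !B0 !scaler0 !addr0 A_sa.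
Qed.
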